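(* Let $k$ and $N$ be positive integers. Let $f:\mathcal{H}\to\mathbb{C}$ be a non-zero function on the upper half-plane $\mathcal{H}=\{z\in\mathbb{C}:\operatorname{Im}(z)>0\}$, and let $g=f|_kW_N$, that is, $g(z)=(\sqrt{N}z)^{-k}f\left(\frac{-1}{Nz}\right)$. Suppose that $f$ and $g$ have Fourier series expansions $$f(z)=\sum_{n\ge 0}a_ne^{2\pi inz}\quad\text{and}\quad g(z)=\sum_{n\ge 0}b_ne^{2\pi inz}\qquad (z\in\mathcal{H}),$$ with complex coefficients, and that the coefficients satisfy $a_n=O(n^\alpha)$ and $b_n=O(n^\alpha)$ for $n\ge 1$, where $\alpha$ is a positive constant. (1) If $a_0=0$ and $b_n$ is real for every $n\ge 1$, then the sequence $\{b_n\}_{n=1}^\infty$ changes signs infinitely often. (2) If $b_0=0$ and $a_n$ is real for every $n\ge 1$, then the sequence $\{a_n\}_{n=1}^\infty$ changes signs infinitely often.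
   Context: A sequence of real numbers changes signs infinitely often if it has infinitely many strictly positive terms and infinitely many strictly negative terms. *)

(* Defs.v *)
(* Stdlib reals with Coquelicot's complex numbers and series. *)
From Stdlib Require Import Reals.
From Coquelicot Require Import Coquelicot.

Open Scope R_scope.

Definition upper_half_plane (z : C) : Prop := 0 < Im z.

Definition Cexp (z : C) : C :=
  (exp (Re z) * cos (Im z), exp (Re z) * sin (Im z)).

(* Only the values of [f] on the upper half-plane matter when [z] lies there,
   since z |-> -1/(N z) preserves the upper half-plane. *)
Definition slash_W (k N : nat) (f : C -> C) (z : C) : C :=
  (/ pow_n (K := C_Ring) (RtoC (sqrt (INR N)) * z) k
   * f (RtoC (-1) / (RtoC (INR N) * z)))%C.

Definition has_fourier_expansion (f : C -> C) (a : nat -> C) : Prop :=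
  forall z : C, upper_half_plane z ->
    is_series (K := C_AbsRing) (V := C_NormedModule)
      (fun n : nat => (a n * Cexp (RtoC (2 * PI) * Ci * RtoC (INR n) * z))%C)
      (f z).

(* The bound is not imposed on [a 0]. *)
Definition coeff_bigO_pow (a : nat -> C) (alpha : R) : Prop :=
  exists M : R, forall n : nat, (1 <= n)%nat ->
    Cmod (a n) <= M * Rpower (INR n) alpha.

Definition changes_signs_infinitely_often (u : nat -> R) : Prop :=
  (forall m : nat, exists n : nat, (m <= n)%nat /\ 0 < u n) /\
  (forall m : nat, exists n : nat, (m <= n)%nat /\ u n < 0).

(* Main.v *)
Require Import Defs.
From Stdlib Require Import Reals Lra Lia Classical.
From Coquelicot Require Import Coquelicot.

(** On the imaginary axis, [a 0 = 0] makes [f (i y)] exponentially small as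
    [y] tends to infinity.  The relation [g = f|W_N] turns this into decay of
    [g (i y)] faster than every power of [y] as [y] tends to [0]
    ([fricke_flat_imaginary_axis]).  So everything rests on a statement about
    one real variable: if [h t = sum_n c_n e^(-nt)] is flat at [0+] and [c_n]
    is eventually of one sign, then [c_n = 0] for all [n >= 1]
    ([flat_coeffs_zero]).

    The idea behind it is the classical one: flatness says that the Dirichlet
    series [sum_n c_n n^(-s)] continues to an entire function vanishing at all
    negative integers, Landau's lemma makes it converge there when the signs
    are eventually constant, and [sum_n c_n n^m = 0] for all [m >= 1] is
    impossible because large [n] dominate.  Analytic continuation is avoided as
    follows.  Finite differences of the dilates [h (i t)] give
    [sum_n c_n e^(-nt) (1 - e^(-nt))^m], which is again flat
    ([flat_at_0_finite_difference]); for [m >= 1] the constant term [c_0] has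
    dropped out.  If [c_n >= 0] for [n > p], every truncation at an index
    [>= p] is bounded by the whole sum, and dividing by [t^m] and letting [t]
    tend to [0] yields [sum_(n <= q) c_n n^m <= 0] for every [q >= p] and every
    [m] ([flat_power_moments_nonpos]).  As [m] grows the last term dominates,
    so [c_q <= 0] ([dominant_coeff_nonpos]).  Thus [c_n = 0] for all [n > p],
    and the remaining coefficients are removed from the top down, since a
    finite sum counts as eventually of either sign.

    Consequently, if [Re b_n] were eventually of one sign, [g] would be the
    constant [b_0], which flatness forces to be [0], and then [f] would vanish
    as well.  The Fricke involution only enters through absolute values, and in
    that form the relation is symmetric in [f] and [g]
    ([fricke_related_sym]), so both halves of the theorem are the same
    statement. *)

(** * Functions flat at zero *)

Lemma exp_monotone (x y : R) : x <= y -> exp x <= exp y.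
Proof. intros [H| ->]; [now apply Rlt_le, exp_increasing|apply Rle_refl]. Qed.

(** The Mellin transform of a function with this property converges
    arbitrarily far to the left: flatness is the real-variable substitute for
    an entire completed L-function. *)
Definition flat_at_0 (h : R -> R) : Prop :=
  forall M : nat, exists K d : R, 0 < d /\
    forall t, 0 < t < d -> Rabs (h t) <= K * t ^ M.

Lemma flat_at_0_minus (h1 h2 : R -> R) :
  flat_at_0 h1 -> flat_at_0 h2 -> flat_at_0 (fun t => h1 t - h2 t).
Proof.
intros H1 H2 M.
destruct (H1 M) as [K1 [d1 [Hd1 B1]]], (H2 M) as [K2 [d2 [Hd2 B2]]].
exists (K1 + K2), (Rmin d1 d2); split; [now apply Rmin_pos|].
intros t Ht.
pose proof (Rmin_l d1 d2); pose proof (Rmin_r d1 d2).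
specialize (B1 t ltac:(lra)); specialize (B2 t ltac:(lra)).
pose proof (Rabs_triang (h1 t) (- h2 t)) as Htri.
rewrite Rabs_Ropp in Htri; unfold Rminus; lra.
Qed.

Lemma flat_at_0_opp (h : R -> R) : flat_at_0 h -> flat_at_0 (fun t => - h t).
Proof.
intros H M; destruct (H M) as [K [d [Hd B]]]; exists K, d; split; [easy|].
intros t Ht; rewrite Rabs_Ropp; now apply B.
Qed.

Lemma flat_at_0_dilate (h : R -> R) (c : R) :
  0 < c -> flat_at_0 h -> flat_at_0 (fun t => h (c * t)).
Proof.
intros Hc H M.
destruct (H M) as [K [d [Hd B]]].
exists (K * c ^ M), (d / c); split; [now apply Rdiv_lt_0_compat|].
intros t [Ht0 Ht].
rewrite Rmult_assoc, <- Rpow_mult_distr.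
apply B; split; [nra|].
apply (Rmult_lt_compat_l c) in Ht; [|easy].
now replace (c * (d / c)) with d in Ht by (field; lra).
Qed.

(** Since [e^(-int) (1 - e^(-nt))^(m+1)] is the difference of the terms for
    [(i, m)] and [(i + 1, m)], the case [m = 0], which is the dilate
    [h (i t)], propagates to every [m].  Keeping [i >= 1] avoids the value of
    the series at [t = 0], where convergence is unknown. *)
Lemma flat_at_0_finite_difference (c : nat -> R) (h : R -> R)
  (Hser : forall t, 0 < t -> is_series (fun n => c n * exp (- (INR n * t))) (h t))
  (Hflat : flat_at_0 h) (m : nat) :
  forall i : nat, (1 <= i)%nat -> exists T : R -> R, flat_at_0 T /\
    forall t, 0 < t ->
      is_series (fun n => c n * (exp (- (INR n * (INR i * t)))
                                 * (1 - exp (- (INR n * t))) ^ m)) (T t).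
Proof.
induction m as [|m IH]; intros i Hi.
- assert (Hi0 : 0 < INR i) by (apply lt_0_INR; lia).
  exists (fun t => h (INR i * t)); split; [now apply flat_at_0_dilate|].
  intros t Ht.
  apply is_series_ext with (fun n => c n * exp (- (INR n * (INR i * t)))).
  { intros n; simpl; ring. }
  apply Hser; nra.
- destruct (IH i Hi) as [T1 [F1 S1]].
  destruct (IH (S i) ltac:(lia)) as [T2 [F2 S2]].
  exists (fun t => T1 t - T2 t); split; [now apply flat_at_0_minus|].
  intros t Ht.
  generalize (is_series_minus _ _ _ _ (S1 t Ht) (S2 t Ht)).
  apply is_series_ext; intros n.
  change (c n * (exp (- (INR n * (INR i * t))) * (1 - exp (- (INR n * t))) ^ m)
    - c n * (exp (- (INR n * (INR (S i) * t))) * (1 - exp (- (INR n * t))) ^ m)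
    = c n * (exp (- (INR n * (INR i * t))) * (1 - exp (- (INR n * t))) ^ S m)).
  replace (- (INR n * (INR (S i) * t)))
    with (- (INR n * (INR i * t)) + - (INR n * t)) by (rewrite S_INR; ring).
  rewrite exp_plus, <- tech_pow_Rmult; ring.
Qed.

(** * Coefficients of a flat exponential series *)

Lemma sum_n_le_series (u : nat -> R) (l : R) (p : nat) :
  is_series u l -> (forall n, (p < n)%nat -> 0 <= u n) -> sum_n u p <= l.
Proof.
intros Hl Hpos.
apply (is_lim_seq_le_loc (fun _ => sum_n u p) (sum_n u) (sum_n u p) l);
  [|apply is_lim_seq_const|exact Hl].
exists p; intros n Hn; induction Hn as [|n Hn IHn]; [lra|].
rewrite sum_Sn; unfold plus; simpl.
specialize (Hpos (S n) ltac:(lia)); lra.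
Qed.

Lemma is_lim_sum_n (u : nat -> R -> R) (l : nat -> R) (x : R) (p : nat) :
  (forall n, is_lim (u n) x (l n)) ->
  is_lim (fun t => sum_n (fun n => u n t) p) x (sum_n l p).
Proof.
intros Hu; induction p as [|p IH].
- rewrite sum_O; apply is_lim_ext with (u 0%nat); [|apply Hu].
  intros t; now rewrite sum_O.
- rewrite sum_Sn.
  apply is_lim_ext with (fun t => sum_n (fun n => u n t) p + u (S p) t).
  { intros t; now rewrite sum_Sn. }
  now apply (is_lim_plus' _ _ x).
Qed.

Lemma is_lim_pow (u : R -> R) (x l : R) (m : nat) :
  is_lim u x l -> is_lim (fun t => u t ^ m) x (l ^ m).
Proof.
intros Hu; induction m as [|m IH]; simpl; [apply is_lim_const|].
now apply (is_lim_mult u _ x l (l ^ m)).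
Qed.

Lemma is_lim_exp_scale (a : R) : is_lim (fun t => exp (- (a * t))) 0 1.
Proof.
replace 1 with (exp (- (a * 0))) by (rewrite Rmult_0_r, Ropp_0; apply exp_0).
apply (is_lim_continuity (fun t => exp (- (a * t)))), derivable_continuous_pt.
exists (- a * exp (- (a * 0))); apply is_derive_Reals; auto_derive; [easy|ring].
Qed.

Lemma is_lim_exp_slope (a : R) : is_lim (fun t => (1 - exp (- (a * t))) / t) 0 a.
Proof.
assert (D : is_derive (fun t => 1 - exp (- (a * t))) 0 a).
{ auto_derive; [easy|]; rewrite Rmult_0_r, Ropp_0, exp_0; ring. }
apply is_derive_Reals in D.
apply is_lim_spec; intros eps.
destruct (D eps (cond_pos eps)) as [d Hd].
exists d; intros t Ht Ht0.
change (Rabs (t - 0) < d) in Ht; rewrite Rminus_0_r in Ht.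
specialize (Hd t Ht0 Ht).
now rewrite Rplus_0_l, Rmult_0_r, Ropp_0, exp_0, Rminus_diag, Rminus_0_r in Hd.
Qed.

(** The discarded tail of the [m]-th difference is nonnegative, so the
    truncation inherits its upper bound [O(t^(m+1))]; after division by [t^m]
    each factor [(1 - e^(-nt)) / t] tends to [n]. *)
Lemma flat_power_moments_nonpos (c : nat -> R) (h : R -> R)
  (Hser : forall t, 0 < t -> is_series (fun n => c n * exp (- (INR n * t))) (h t))
  (Hflat : flat_at_0 h) (p : nat)
  (Hpos : forall n, (p < n)%nat -> 0 <= c n) (m : nat) :
  sum_n (fun n => c n * INR n ^ m) p <= 0.
Proof.
destruct (flat_at_0_finite_difference c h Hser Hflat m 1 (le_n 1)) as [T [FT ST]].
(* One power of [t] more than the division by [t^m] consumes. *)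
destruct (FT (S m)) as [K [d [Hd B]]].
set (Q := fun t : R => sum_n (fun n => c n * (exp (- (INR n * t))
            * ((1 - exp (- (INR n * t))) / t) ^ m)) p).
assert (HQ : is_lim Q 0 (sum_n (fun n => c n * INR n ^ m) p)).
{ apply (is_lim_sum_n (fun n t => c n * (exp (- (INR n * t))
            * ((1 - exp (- (INR n * t))) / t) ^ m))); intros n.
  apply (is_lim_mult (fun _ => c n) _ 0 (c n) (INR n ^ m));
    [apply is_lim_const| |easy].
  rewrite <- (Rmult_1_l (INR n ^ m)).
  apply (is_lim_mult (fun t => exp (- (INR n * t))) _ 0 1 (INR n ^ m));
    [apply is_lim_exp_scale| |easy].
  apply is_lim_pow, is_lim_exp_slope. }
assert (HK : is_lim (fun t => K * t) 0 0).
{ rewrite <- (Rmult_0_r K) at 2.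
  apply (is_lim_mult (fun _ => K) (fun t => t) 0 K 0);
    [apply is_lim_const|apply is_lim_id|easy]. }
assert (Hle : filter_le (at_right 0) (Rbar_locally' 0)).
{ intros P [e He]; exists e; intros t Ht Ht0; apply He; [easy|lra]. }
apply (@filterlim_le R (at_right 0) _ Q (fun t => K * t)
         (sum_n (fun n => c n * INR n ^ m) p) 0);
  [|exact (filterlim_filter_le_1 _ Hle HQ)|exact (filterlim_filter_le_1 _ Hle HK)].
exists (mkposreal d Hd); intros t Ht Ht0.
change (Rabs (t - 0) < d) in Ht; rewrite Rminus_0_r, Rabs_pos_eq in Ht by lra.
assert (Htm : 0 < t ^ m) by now apply pow_lt.
apply Rmult_le_reg_r with (t ^ m); [easy|].
replace (K * t * t ^ m) with (K * t ^ S m) by (simpl; ring).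
refine (Rle_trans _ _ _ _ (Rle_trans _ _ _ (Rle_abs _) (B t (conj Ht0 Ht)))).
refine (Rle_trans _ _ _ _ (sum_n_le_series _ _ p (ST t Ht0) _)).
- apply Req_le; unfold Q.
  rewrite <- (sum_n_mult_r (K := R_Ring) (t ^ m)).
  apply sum_n_ext; intros n; unfold mult; simpl.
  unfold Rdiv; rewrite Rpow_mult_distr, pow_inv, Rmult_1_l; field; lra.
- intros n Hn; specialize (Hpos n Hn).
  assert (0 <= 1 - exp (- (INR n * t))).
  { pose proof (pos_INR n).
    assert (exp (- (INR n * t)) <= exp 0) by (apply exp_monotone; nra).
    rewrite exp_0 in *; lra. }
  apply Rmult_le_pos; [easy|].
  apply Rmult_le_pos; [apply Rlt_le, exp_pos|now apply pow_le].
Qed.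

(** Divided by [(p+1)^m], all terms but the last tend to [0] as [m] grows. *)
Lemma dominant_coeff_nonpos (c : nat -> R) (p : nat) :
  (forall m, sum_n (fun n => c n * INR n ^ m) (S p) <= 0) -> c (S p) <= 0.
Proof.
intros Hm.
assert (Hp : 0 < INR (S p)) by (apply lt_0_INR; lia).
assert (HL : is_lim_seq
   (fun m => sum_n (fun n => c n * (INR n / INR (S p)) ^ m) p + c (S p)) (c (S p))).
{ replace (Finite (c (S p))) with (Finite (0 + c (S p))) by (f_equal; ring).
  apply (is_lim_seq_plus' _ _ 0 (c (S p))); [|apply is_lim_seq_const].
  assert (Hq : forall q, (q <= p)%nat ->
     is_lim_seq (fun m => sum_n (fun n => c n * (INR n / INR (S p)) ^ m) q) 0).
  { assert (Hterm : forall n, (n <= p)%nat ->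
       is_lim_seq (fun m => c n * (INR n / INR (S p)) ^ m) 0).
    { intros n Hn; rewrite <- (Rmult_0_r (c n)).
      apply (is_lim_seq_scal_l (fun m => (INR n / INR (S p)) ^ m) (c n) 0).
      apply is_lim_seq_geom.
      rewrite Rabs_pos_eq by (apply Rdiv_le_0_compat; [apply pos_INR|easy]).
      apply Rlt_div_l; [easy|]; rewrite Rmult_1_l; apply lt_INR; lia. }
    induction q as [|q IH]; intros Hq.
    - apply is_lim_seq_ext with (2 := Hterm 0%nat ltac:(lia)).
      intros m; now rewrite sum_O.
    - rewrite <- (Rplus_0_l 0).
      apply is_lim_seq_ext with
        (2 := is_lim_seq_plus' _ _ _ _ (IH ltac:(lia)) (Hterm (S q) Hq)).
      intros m; now rewrite sum_Sn. }
  now apply Hq. }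
apply (is_lim_seq_le _ (fun _ => 0) (c (S p)) 0) with (2 := HL);
  [|apply is_lim_seq_const].
intros m.
assert (Hpm : 0 < INR (S p) ^ m) by now apply pow_lt.
apply Rmult_le_reg_r with (INR (S p) ^ m); [easy|]; rewrite Rmult_0_l.
refine (Rle_trans _ _ _ _ (Hm m)); apply Req_le.
rewrite sum_Sn, Rmult_plus_distr_r; apply f_equal2; [|easy].
rewrite <- (sum_n_mult_r (K := R_Ring) (INR (S p) ^ m)).
apply sum_n_ext; intros n.
change (c n * (INR n / INR (S p)) ^ m * INR (S p) ^ m = c n * INR n ^ m).
unfold Rdiv; rewrite Rpow_mult_distr, pow_inv.
field; apply Rgt_not_eq, Hpm.
Qed.

(** A Landau-type rigidity statement; [c 0] is exempt because every finite
    difference annihilates constants. *)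
Lemma flat_coeffs_zero (c : nat -> R) (h : R -> R)
  (Hser : forall t, 0 < t -> is_series (fun n => c n * exp (- (INR n * t))) (h t))
  (Hflat : flat_at_0 h) (p : nat)
  (Hpos : forall n, (p < n)%nat -> 0 <= c n) :
  forall n, (1 <= n)%nat -> c n = 0.
Proof.
assert (Htop : forall (e : nat -> R) (h' : R -> R),
  (forall t, 0 < t -> is_series (fun n => e n * exp (- (INR n * t))) (h' t)) ->
  flat_at_0 h' -> forall q, (forall n, (q < n)%nat -> 0 <= e n) ->
  forall n, (q <= n)%nat -> (1 <= n)%nat -> e n <= 0).
{ intros e h' Se Fe q He n Hqn Hn.
  destruct n as [|n]; [lia|].
  apply dominant_coeff_nonpos; intros m.
  apply (flat_power_moments_nonpos e h' Se Fe).
  intros j Hj; apply He; lia. }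
(* Once [c] vanishes beyond an index, both [c] and [- c] are eventually
   nonnegative, so the coefficient at that index is squeezed from both sides. *)
assert (Hstep : forall q, (forall n, (q < n)%nat -> c n = 0) ->
          forall n, (1 <= n)%nat -> c n = 0).
{ induction q as [|q IH]; intros Hq; [intros n Hn; apply Hq; lia|].
  apply IH; intros n Hn.
  destruct (Nat.eq_dec n (S q)) as [->|Hne]; [|apply Hq; lia].
  apply Rle_antisym.
  - apply (Htop c h Hser Hflat (S q)); try lia.
    intros j Hj; rewrite Hq; [lra|easy].
  - apply Ropp_le_cancel; rewrite Ropp_0.
    apply (Htop (fun n => - c n) (fun t => - h t)) with (q := S q); try lia.
    + intros t Ht; generalize (is_series_opp _ _ (Hser t Ht)).
      apply is_series_ext; intros j; unfold opp; simpl; ring.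
    + now apply flat_at_0_opp.
    + intros j Hj; rewrite Hq; [lra|easy]. }
apply (Hstep p); intros n Hn; apply Rle_antisym; [|now apply Hpos].
apply (Htop c h Hser Hflat p); [easy|lia|lia].
Qed.

(** * Complex series and Fourier expansions on the imaginary axis *)

Lemma pow_le_exp (y : R) (n : nat) : 0 <= y -> y ^ n <= exp (INR n * y).
Proof.
intros Hy; induction n as [|n IH].
- rewrite Rmult_0_l, exp_0; simpl; lra.
- replace (INR (S n) * y) with (y + INR n * y) by (rewrite S_INR; ring).
  rewrite exp_plus; simpl.
  pose proof (exp_ineq1_le y).
  apply Rmult_le_compat; [easy|now apply pow_le|lra|easy].
Qed.

Lemma exp_opp_le_pow (x : R) (p : nat) :
  (0 < p)%nat -> 0 < x -> exp (- x) <= (INR p / x) ^ p.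
Proof.
intros Hp Hx.
assert (Hp' : 0 < INR p) by now apply lt_0_INR.
assert (Hq : 0 < x / INR p) by now apply Rdiv_lt_0_compat.
generalize (pow_le_exp (x / INR p) p (Rlt_le _ _ Hq)).
replace (INR p * (x / INR p)) with x by (field; lra).
replace (INR p / x) with (/ (x / INR p)) by (field; lra).
rewrite exp_Ropp, pow_inv; intros H.
apply Rinv_le_contravar; [now apply pow_lt|easy].
Qed.

Lemma Cmod_is_series_le (u : nat -> C) (l : C) (v : nat -> R) (B : R) :
  is_series (K := C_AbsRing) (V := C_NormedModule) u l ->
  (forall n, Cmod (u n) <= v n) -> is_series v B -> Cmod l <= B.
Proof.
intros Hu Huv Hv.
apply (is_lim_seq_le (fun n => Cmod (sum_n u n)) (sum_n v) (Cmod l) B);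
  [|exact (filterlim_comp _ _ _ _ _ _ _ _ Hu (filterlim_norm (V := C_NormedModule) l))
   |exact Hv].
intros n.
refine (Rle_trans _ _ _ (norm_sum_n_m (V := C_NormedModule) u 0 n) _).
now apply sum_n_m_le.
Qed.

Lemma is_series_Re (u : nat -> C) (l : C) :
  is_series (K := C_AbsRing) (V := C_NormedModule) u l ->
  is_series (fun n => Re (u n)) (Re l).
Proof.
intros Hu.
apply filterlim_ext with (fun n => Re (sum_n u n)).
{ induction x as [|n IH]; [now rewrite !sum_O|].
  now rewrite !sum_Sn, <- IH. }
refine (filterlim_comp _ _ _ _ Re _ _ _ Hu _).
intros P [e He]; exists e; intros z [Hz _]; now apply He.
Qed.

Lemma Cexp_imaginary_axis (n : nat) (y : R) :
  Cexp (RtoC (2 * PI) * Ci * RtoC (INR n) * (0, y))%C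
  = RtoC (exp (- (INR n * (2 * PI * y)))).
Proof.
replace (RtoC (2 * PI) * Ci * RtoC (INR n) * (0, y))%C
  with (RtoC (- (INR n * (2 * PI * y)))).
- unfold Cexp, RtoC; simpl; rewrite cos_0, sin_0; f_equal; ring.
- apply injective_projections; simpl; ring.
Qed.

(** Convergence at height [1] bounds [|a_n| e^(-2 pi n)].  For [n >= 1] and
    [y >= 2], [n (y - 1) >= (y - 1) + (n - 1)] then leaves a geometric series
    in [e^(-2 pi)] with the factor [e^(-2 pi y)] in front. *)
Lemma fourier_cusp_decay (f : C -> C) (a : nat -> C) :
  has_fourier_expansion f a -> a 0%nat = RtoC 0 ->
  exists K, 0 <= K /\
    forall y, 2 <= y -> Cmod (f (0, y)) <= K * exp (- (2 * PI * y)).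
Proof.
intros Hf Ha0.
pose proof PI_RGT_0 as Hpi.
assert (Hr : 0 < exp (- (2 * PI)) < 1).
{ split; [apply exp_pos|rewrite <- exp_0; apply exp_increasing; lra]. }
assert (HB : exists K, forall n, Cmod (a n) * exp (- (INR n * (2 * PI))) <= K).
{ set (u := fun n => (a n * Cexp (RtoC (2 * PI) * Ci * RtoC (INR n) * (0%R, 1%R)))%C).
  destruct (filterlim_bounded (V := C_NormedModule) (sum_n u)) as [K HK].
  { exists (f (0, 1)); apply Hf; unfold upper_half_plane; simpl; lra. }
  change (forall n, Cmod (sum_n u n) <= K) in HK.
  exists (K + K); intros n.
  replace (Cmod (a n) * exp (- (INR n * (2 * PI)))) with (Cmod (u n)).
  2: { unfold u; rewrite Cexp_imaginary_axis, Cmod_mult, Cmod_R, Rmult_1_r.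
       f_equal; apply Rabs_pos_eq, Rlt_le, exp_pos. }
  assert (HK0 := Rle_trans _ _ _ (Cmod_ge_0 _) (HK 0%nat)).
  destruct n as [|n].
  { generalize (HK 0%nat); rewrite sum_O; lra. }
  (* A term is a difference of two bounded partial sums. *)
  replace (u (S n)) with (sum_n u (S n) - sum_n u n)%C.
  2: { rewrite sum_Sn; unfold plus; simpl; ring. }
  refine (Rle_trans _ _ _ (Cmod_triangle _ _) _); rewrite Cmod_opp.
  now apply Rplus_le_compat. }
destruct HB as [K HK].
assert (HK0 : 0 <= K).
{ refine (Rle_trans _ _ _ _ (HK 0%nat)).
  apply Rmult_le_pos; [apply Cmod_ge_0|apply Rlt_le, exp_pos]. }
exists (K * exp (4 * PI) * / (1 - exp (- (2 * PI)))); split.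
{ apply Rmult_le_pos; [apply Rmult_le_pos; [easy|apply Rlt_le, exp_pos]|].
  apply Rlt_le, Rinv_0_lt_compat; lra. }
intros y Hy.
assert (Hz : upper_half_plane (0, y)) by (unfold upper_half_plane; simpl; lra).
apply (Cmod_is_series_le _ _
  (fun n => (K * exp (4 * PI) * exp (- (2 * PI * y))) * exp (- (2 * PI)) ^ n) _ (Hf _ Hz)).
- intros n; rewrite Cexp_imaginary_axis, Cmod_mult, Cmod_R.
  rewrite (Rabs_pos_eq (exp _)) by apply Rlt_le, exp_pos.
  destruct n as [|n].
  { rewrite Ha0, Cmod_0, Rmult_0_l, pow_O, Rmult_1_r.
    apply Rmult_le_pos; [apply Rmult_le_pos; [easy|]|]; apply Rlt_le, exp_pos. }
  assert (Epow : forall j, exp (- (2 * PI)) ^ j = exp (- (INR j * (2 * PI)))).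
  { induction j as [|j IH]; [simpl; now rewrite Rmult_0_l, Ropp_0, exp_0|].
    rewrite <- tech_pow_Rmult, IH, <- exp_plus, S_INR; f_equal; ring. }
  rewrite Epow.
  replace (- (INR (S n) * (2 * PI * y)))
    with (- (INR (S n) * (2 * PI)) + - (INR (S n) * (2 * PI * (y - 1)))) by ring.
  rewrite exp_plus, <- Rmult_assoc.
  apply Rle_trans with (K * exp (- (INR (S n) * (2 * PI * (y - 1))))).
  { apply Rmult_le_compat_r; [apply Rlt_le, exp_pos|apply HK]. }
  rewrite !Rmult_assoc, <- !exp_plus.
  apply Rmult_le_compat_l; [easy|].
  assert (Hn := pos_INR n).
  apply exp_monotone.
  assert (0 <= INR n * (PI * (y - 2))).
  { apply Rmult_le_pos; [easy|apply Rmult_le_pos; lra]. }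
  rewrite S_INR; nra.
- replace (K * exp (4 * PI) * / (1 - exp (- (2 * PI))) * exp (- (2 * PI * y)))
    with (scal (K * exp (4 * PI) * exp (- (2 * PI * y))) (/ (1 - exp (- (2 * PI)))))
    by (unfold scal; simpl; unfold mult; simpl; ring).
  apply (is_series_scal (K * exp (4 * PI) * exp (- (2 * PI * y)))
           (fun n => exp (- (2 * PI)) ^ n)), is_series_geom.
  rewrite Rabs_pos_eq; lra.
Qed.

(** * The Fricke involution *)

(** The slash relation in absolute values: the factor [(-1)^k] that appears
    when [f] and [g] are exchanged disappears, which makes it symmetric. *)
Definition fricke_related (k N : nat) (f g : C -> C) : Prop :=
  forall z : C, upper_half_plane z ->
    Cmod (g z) * (sqrt (INR N) * Cmod z) ^ k
    = Cmod (f (RtoC (-1) / (RtoC (INR N) * z))%C).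

Lemma RtoC_neq_0 (x : R) : x <> 0 -> RtoC x <> RtoC 0.
Proof. intros Hx E; now apply Hx, RtoC_inj. Qed.

Lemma upper_half_plane_neq_0 (z : C) : upper_half_plane z -> z <> RtoC 0.
Proof. intros Hz ->; unfold upper_half_plane in Hz; simpl in Hz; lra. Qed.

Lemma fricke_point_upper (N : nat) (z : C) : (0 < N)%nat ->
  upper_half_plane z -> upper_half_plane (RtoC (-1) / (RtoC (INR N) * z))%C.
Proof.
intros HN; destruct z as [x y]; unfold upper_half_plane; simpl; intros Hy.
assert (0 < INR N) by now apply lt_0_INR.
assert (Hq : 0 < x * x + y * y) by nra.
match goal with |- 0 < ?e =>
  replace e with (y / (INR N * (x * x + y * y))) end.
- apply Rdiv_lt_0_compat; [easy|now apply Rmult_lt_0_compat].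
- field; repeat split; try lra.
  apply Rgt_not_eq.
  replace (INR N * x * (INR N * x) + INR N * y * (INR N * y))
    with (INR N * INR N * (x * x + y * y)) by ring.
  now repeat apply Rmult_lt_0_compat.
Qed.

Lemma fricke_point_involutive (N : nat) (z : C) : (0 < N)%nat ->
  z <> RtoC 0 ->
  (RtoC (-1) / (RtoC (INR N) * (RtoC (-1) / (RtoC (INR N) * z))))%C = z.
Proof.
intros HN Hz.
assert (RtoC (INR N) <> 0%C) by (apply RtoC_neq_0, not_0_INR; lia).
field; repeat split; try easy.
Qed.

Lemma fricke_point_Cmod (N : nat) (z : C) : (0 < N)%nat -> z <> RtoC 0 ->
  (sqrt (INR N) * Cmod z)
  * (sqrt (INR N) * Cmod (RtoC (-1) / (RtoC (INR N) * z))%C) = 1.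
Proof.
intros HN Hz.
assert (HN0 : 0 < INR N) by now apply lt_0_INR.
assert (Hs := sqrt_lt_R0 _ HN0).
assert (Hz0 : 0 < Cmod z) by now apply Cmod_gt_0.
assert (HNz : (RtoC (INR N) * z)%C <> 0%C).
{ apply Cmult_neq_0; [apply RtoC_neq_0; lra|easy]. }
rewrite Cmod_div, Cmod_mult, !Cmod_R, Rabs_left, Rabs_pos_eq by (lra || easy).
rewrite <- (sqrt_sqrt (INR N)) at 3 by lra.
field; lra.
Qed.

Lemma fricke_related_sym (k N : nat) (f g : C -> C) : (0 < N)%nat ->
  fricke_related k N f g -> fricke_related k N g f.
Proof.
intros HN H z Hz.
assert (Hz0 := upper_half_plane_neq_0 z Hz).
assert (Hw := H _ (fricke_point_upper N z HN Hz)).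
rewrite fricke_point_involutive in Hw by easy.
rewrite <- Hw, Rmult_assoc, <- Rpow_mult_distr.
rewrite (Rmult_comm (sqrt (INR N) * _)), fricke_point_Cmod by easy.
rewrite pow1; ring.
Qed.

Lemma slash_W_fricke_related (k N : nat) (f g : C -> C) : (0 < N)%nat ->
  (forall z : C, upper_half_plane z -> g z = slash_W k N f z) ->
  fricke_related k N f g.
Proof.
intros HN H z Hz; rewrite (H z Hz); unfold slash_W.
assert (HN0 : 0 < sqrt (INR N)) by now apply sqrt_lt_R0, lt_0_INR.
assert (Hz0 : 0 < Cmod z) by now apply Cmod_gt_0, upper_half_plane_neq_0.
assert (E : forall w j, Cmod (pow_n (K := C_Ring) w j) = Cmod w ^ j).
{ intros w; induction j as [|j IH]; [apply Cmod_1|].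
  simpl; rewrite <- IH; apply Cmod_mult. }
assert (P : 0 < (sqrt (INR N) * Cmod z) ^ k) by (apply pow_lt; nra).
assert (E1 : Cmod (pow_n (K := C_Ring) (RtoC (sqrt (INR N)) * z)%C k)
             = (sqrt (INR N) * Cmod z) ^ k).
{ now rewrite E, Cmod_mult, Cmod_R, Rabs_pos_eq by lra. }
rewrite Cmod_mult, Cmod_inv, E1.
- field; lra.
- apply Cmod_gt_0; now rewrite E1.
Qed.

(** The point [i y] goes to [i / (N y)], where for small [y] the function [f] is
    at most a multiple of [e^(-2 pi / (N y))]; this beats the factor [y^(-k)] together with any
    prescribed power of [y]. *)
Lemma fricke_flat_imaginary_axis (k N : nat) (f g : C -> C) (a : nat -> C) :
  (0 < k)%nat -> (0 < N)%nat -> fricke_related k N f g ->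
  has_fourier_expansion f a -> a 0%nat = RtoC 0 ->
  flat_at_0 (fun t => Cmod (g (0, t / (2 * PI)))).
Proof.
intros Hk HN Hrel Hf Ha0 M.
destruct (fourier_cusp_decay f a Hf Ha0) as [K [HK0 HK]].
pose proof PI_RGT_0 as Hpi.
assert (HN0 : 0 < INR N) by now apply lt_0_INR.
assert (Hs := sqrt_lt_R0 _ HN0).
(* Of the [p] powers of [t] gained from the exponential, [k] pay for the
   automorphy factor. *)
set (p := (M + k)%nat).
exists (K * (INR p * INR N / (4 * PI * PI)) ^ p / (sqrt (INR N) / (2 * PI)) ^ k),
  (PI / INR N); split; [now apply Rdiv_lt_0_compat|].
intros t [Ht0 Ht].
rewrite Rabs_pos_eq by apply Cmod_ge_0.
assert (Hy : 0 < t / (2 * PI)) by (apply Rdiv_lt_0_compat; lra).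
assert (Hz : upper_half_plane (0, t / (2 * PI))) by easy.
assert (Hg := Hrel _ Hz).
replace (RtoC (-1) / (RtoC (INR N) * (0%R, (t / (2 * PI))%R)))%C
  with ((0, 2 * PI / (INR N * t)) : C) in Hg.
2: { apply injective_projections; simpl; field; repeat split; nra. }
replace (Cmod (0, t / (2 * PI))) with (t / (2 * PI)) in Hg.
2: { unfold Cmod; simpl; rewrite !Rmult_1_r, Rmult_0_l, Rplus_0_l.
     now rewrite sqrt_square by lra. }
assert (Hc : 0 < (sqrt (INR N) / (2 * PI)) ^ k) by (apply pow_lt, Rdiv_lt_0_compat; lra).
assert (Htk : 0 < t ^ k) by now apply pow_lt.
apply Rmult_le_reg_r with ((sqrt (INR N) * (t / (2 * PI))) ^ k).
{ apply pow_lt; nra. }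
rewrite Hg.
apply Rle_trans with (K * (INR p * INR N / (4 * PI * PI) * t) ^ p).
- refine (Rle_trans _ _ _ (HK _ _) (Rmult_le_compat_l _ _ _ HK0 _)).
  + apply Rle_div_r; [nra|].
    apply (Rmult_lt_compat_l (INR N)) in Ht; [|easy].
    replace (INR N * (PI / INR N)) with PI in Ht by (field; lra); lra.
  + replace (INR p * INR N / (4 * PI * PI) * t)
      with (INR p / (2 * PI * (2 * PI / (INR N * t)))) by (field; repeat split; lra).
    apply exp_opp_le_pow; [unfold p; lia|].
    apply Rmult_lt_0_compat; [lra|apply Rdiv_lt_0_compat; nra].
- apply Req_le.
  replace (sqrt (INR N) * (t / (2 * PI))) with (sqrt (INR N) / (2 * PI) * t)
    by (field; lra).
  rewrite !(Rpow_mult_distr _ t); unfold p at 3; rewrite pow_add.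
  field; lra.
Qed.

(** * Sign changes *)

Lemma constant_of_coeffs_zero (g : C -> C) (b : nat -> C) :
  has_fourier_expansion g b -> (forall n, (1 <= n)%nat -> b n = RtoC 0) ->
  forall z, upper_half_plane z -> g z = b 0%nat.
Proof.
intros Hg Hb z Hz.
apply (filterlim_locally_unique (F := eventually) _ _ _ (Hg z Hz)).
apply filterlim_ext with (fun _ : nat => b 0%nat); [|apply filterlim_const].
induction x as [|n IH].
- rewrite sum_O; simpl.
  replace (RtoC (2 * PI) * Ci * RtoC 0 * z)%C with (RtoC 0) by ring.
  unfold Cexp; simpl; rewrite exp_0, cos_0, sin_0, Rmult_1_l, Rmult_0_r.
  symmetry; apply Cmult_1_r.
- rewrite sum_Sn, <- IH, (Hb (S n)) by lia.
  rewrite Cmult_0_l; symmetry; apply Cplus_0_r.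
Qed.

(** The factor [e] stands for the eventual sign, so that the two possible signs
    need only one argument. *)
Lemma fricke_eventually_one_signed (k N : nat) (f g : C -> C) (a b : nat -> C)
  (e : R) (m : nat) :
  (0 < k)%nat -> (0 < N)%nat -> fricke_related k N f g ->
  has_fourier_expansion f a -> has_fourier_expansion g b ->
  a 0%nat = RtoC 0 -> (forall n, (1 <= n)%nat -> Im (b n) = 0) ->
  e <> 0 -> (forall n, (m <= n)%nat -> 0 <= e * Re (b (S n))) ->
  forall z, upper_half_plane z -> g z = RtoC 0.
Proof.
intros Hk HN Hrel Hf Hg Ha0 Him He Hsign.
pose proof PI_RGT_0 as Hpi.
assert (Hflat := fricke_flat_imaginary_axis k N f g a Hk HN Hrel Hf Ha0).
assert (Hb : forall n, (1 <= n)%nat -> b n = RtoC 0).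
{ intros n Hn.
  apply injective_projections; [|now apply Him].
  apply Rmult_eq_reg_l with e; [|easy]; rewrite Rmult_0_r.
  apply (flat_coeffs_zero (fun n => e * Re (b n))
           (fun t => e * Re (g (0, t / (2 * PI))))) with (p := m); [| | |easy].
  - intros t Ht.
    assert (Hz : upper_half_plane (0, t / (2 * PI))).
    { unfold upper_half_plane; simpl; apply Rdiv_lt_0_compat; lra. }
    generalize (is_series_scal (V := R_NormedModule) e _ _ (is_series_Re _ _ (Hg _ Hz))).
    apply is_series_ext; intros j.
    rewrite Cexp_imaginary_axis, re_scal_r.
    replace (2 * PI * (t / (2 * PI))) with t by (field; lra).
    unfold scal; simpl; unfold mult; simpl; ring.
  - intros M; destruct (Hflat M) as [K [d [Hd B]]].
    exists (Rabs e * K), d; split; [easy|]; intros t Ht.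
    rewrite Rabs_mult, Rmult_assoc.
    apply Rmult_le_compat_l; [apply Rabs_pos|].
    specialize (B t Ht); rewrite Rabs_pos_eq in B by apply Cmod_ge_0.
    exact (Rle_trans _ _ _ (re_le_Cmod _) B).
  - intros j Hj; destruct j as [|j]; [lia|]; apply Hsign; lia. }
assert (Hconst := constant_of_coeffs_zero g b Hg Hb).
intros z Hz; rewrite (Hconst z Hz).
apply Cmod_eq_0, Rle_antisym; [|apply Cmod_ge_0].
destruct (Hflat 1%nat) as [K [d [Hd B]]].
(* Now [g] is the constant [b 0], which is [O(t)] as [t] tends to [0]. *)
apply le_epsilon; intros eps Heps; rewrite Rplus_0_l.
set (t := Rmin (d / 2) (eps / (Rabs K + 1))).
assert (HK := Rabs_pos K).
assert (Ht0 : 0 < t) by (apply Rmin_pos; apply Rdiv_lt_0_compat; lra).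
assert (Ht1 : t <= d / 2) by apply Rmin_l.
assert (Ht2 : t <= eps / (Rabs K + 1)) by apply Rmin_r.
apply Rle_div_r in Ht2; [|lra].
specialize (B t ltac:(lra)).
rewrite Rabs_pos_eq, pow_1 in B by apply Cmod_ge_0.
rewrite Hconst in B by (unfold upper_half_plane; simpl; apply Rdiv_lt_0_compat; lra).
assert (HKle := Rle_abs K); nra.
Qed.

Lemma fricke_sign_changes (k N : nat) (f g : C -> C) (a b : nat -> C) :
  (0 < k)%nat -> (0 < N)%nat -> fricke_related k N f g ->
  has_fourier_expansion f a -> has_fourier_expansion g b ->
  a 0%nat = RtoC 0 -> (forall n, (1 <= n)%nat -> Im (b n) = 0) ->
  (exists z, upper_half_plane z /\ g z <> RtoC 0) ->
  changes_signs_infinitely_often (fun n => Re (b (S n))).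
Proof.
intros Hk HN Hrel Hf Hg Ha0 Him [z [Hz Hgz]].
assert (Hone : forall e m, e <> 0 ->
   ~ (forall n, (m <= n)%nat -> 0 <= e * Re (b (S n)))).
{ intros e m He Hm; apply Hgz.
  exact (fricke_eventually_one_signed k N f g a b e m Hk HN Hrel Hf Hg Ha0 Him He Hm z Hz). }
split; intros m; apply NNPP; intros Hno.
- apply (Hone (-1) m); [lra|]; intros n Hn.
  destruct (Rlt_le_dec 0 (Re (b (S n)))) as [Hlt|Hle]; [|lra].
  exfalso; apply Hno; now exists n.
- apply (Hone 1 m); [lra|]; intros n Hn.
  destruct (Rlt_le_dec (Re (b (S n))) 0) as [Hlt|Hle]; [|lra].
  exfalso; apply Hno; now exists n.
Qed.

Lemma fricke_nonzero (k N : nat) (f g : C -> C) : (0 < N)%nat ->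
  fricke_related k N g f ->
  (exists z, upper_half_plane z /\ f z <> RtoC 0) ->
  exists z, upper_half_plane z /\ g z <> RtoC 0.
Proof.
intros HN Hrel [z [Hz Hfz]].
exists (RtoC (-1) / (RtoC (INR N) * z))%C; split; [now apply fricke_point_upper|].
apply Cmod_gt_0; rewrite <- (Hrel z Hz).
apply Rmult_lt_0_compat; [now apply Cmod_gt_0|].
apply pow_lt, Rmult_lt_0_compat; [now apply sqrt_lt_R0, lt_0_INR|].
now apply Cmod_gt_0, upper_half_plane_neq_0.
Qed.

Theorem theorem1 (k N : nat) (hk : (0 < k)%nat) (hN : (0 < N)%nat)
  (f g : C -> C)
  (hf : exists z : C, upper_half_plane z /\ f z <> RtoC 0)
  (hg : forall z : C, upper_half_plane z -> g z = slash_W k N f z)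
  (a b : nat -> C)
  (hfa : has_fourier_expansion f a)
  (hgb : has_fourier_expansion g b)
  (alpha : R) (halpha : (0 < alpha)%R)
  (ha : coeff_bigO_pow a alpha)
  (hb : coeff_bigO_pow b alpha) :
  (a 0%nat = RtoC 0 -> (forall n : nat, (1 <= n)%nat -> Im (b n) = 0%R) ->
     changes_signs_infinitely_often (fun n : nat => Re (b (S n)))) /\
  (b 0%nat = RtoC 0 -> (forall n : nat, (1 <= n)%nat -> Im (a n) = 0%R) ->
     changes_signs_infinitely_often (fun n : nat => Re (a (S n)))).
Proof.
assert (Hfg := slash_W_fricke_related k N f g hN hg).
assert (Hgf := fricke_related_sym k N f g hN Hfg).
split; intros H0 Him.
- apply (fricke_sign_changes k N f g a b); try easy.
  now apply (fricke_nonzero k N f g).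
- now apply (fricke_sign_changes k N g f b a).
Qed.
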